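(* Let $X$ be a pointed metric space and $E$ a Banach space over $\mathbb{K}$. For every map $f\in\mathrm{Lip}_0(X,E^* )$, the functional $\Lambda(f)\colon X\boxtimes E\to\mathbb{K}$, given by $$\Lambda(f)(u)=\sum_{i=1}^n\langle f(x_i)-f(y_i),e_i\rangle$$ for $u=\sum_{i=1}^n \delta_{(x_i,y_i)}\boxtimes e_i\in X\boxtimes E$, is (well defined and) linear. The map $f\mapsto\Lambda(f)$ is a linear monomorphism (injective linear map) from $\mathrm{Lip}_0(X,E^* )$ into the algebraic dual $(X\boxtimes E)'$.
   Context: $\mathbb{K}$ is $\mathbb{R}$ or $\mathbb{C}$. A pointed metric space $X$ is a metric space with a distinguished base point $0$. For a pointed metric space $X$ and a Banach space $F$, $\mathrm{Lip}_0(X,F)$ is the vector space of all Lipschitz maps $f\colon X\to F$ with $f(0)=0$. $E^*$ is the topological dual of $E$ and $\langle\phi,e\rangle=\phi(e)$; $V'$ denotes the algebraic dual of a vector space $V$. For $x,y\in X$ and $e\in E$, $\delta_{(x,y)}\boxtimes e\in \mathrm{Lip}_0(X,E^* )'$ is the linear functional $f\mapsto\langle f(x)-f(y),e\rangle$. The Lipschitz tensor product $X\boxtimes E$ is the linear subspace of $\mathrm{Lip}_0(X,E^* )'$ spanned by all the functionals $\delta_{(x,y)}\boxtimes e$ with $x,y\in X$, $e\in E$. Every $u\in X\boxtimes E$ can be written (non-uniquely) as $u=\sum_{i=1}^n\delta_{(x_i,y_i)}\boxtimes e_i$. *)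

(* Defs.v *)
From HB Require Import structures.
From mathcomp Require Import all_boot all_order all_algebra.
From mathcomp Require Import complex.
From mathcomp Require Import boolp classical_sets functions reals.
From mathcomp Require Import topology normedtype.

Set Implicit Arguments.
Unset Strict Implicit.
Unset Printing Implicit Defensive.

Set Warnings "-redundant-canonical-projection".

Import Order.TTheory GRing.Theory Num.Theory.
Import numFieldNormedType.Exports.

Local Open Scope classical_set_scope.
Local Open Scope ring_scope.

(* The scalar field is R or R[i]. Norms of a normedModType K take their values
   in K, while distances and suprema are taken in the real field R; the two are
   related by [of_real] and [modulus]. *)
Variant scalar_kind := RealScalars | ComplexScalars.

Definition scalars (R : realType) (k : scalar_kind) : numFieldType :=
  match k with
  | RealScalars => R
  | ComplexScalars => R[i]
  end.

Definition of_real (R : realType) (k : scalar_kind) : R -> scalars R k :=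
  match k with
  | RealScalars => fun x => x
  | ComplexScalars => fun x => real_complex R x
  end.

Definition modulus (R : realType) (k : scalar_kind) : scalars R k -> R :=
  match k with
  | RealScalars => fun x => `|x|
  | ComplexScalars => fun z => Normc.normc z
  end.

Section scalars_theory.
Variables (R : realType) (k : scalar_kind).
Local Notation of_real := (@of_real R k).

Lemma of_realD : {morph of_real : x y / x + y}.
Proof. by case: k => // x y; exact: (rmorphD (real_complex R)). Qed.

Lemma of_realM : {morph of_real : x y / x * y}.
Proof. by case: k => // x y; exact: (rmorphM (real_complex R)). Qed.

Lemma of_real0 : of_real 0 = 0.
Proof. by case: k. Qed.

Lemma ler_of_real : {mono of_real : x y / x <= y}.
Proof. by case: k => // x y; exact: lecR. Qed.

Lemma of_real_inj : injective of_real.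
Proof. by case: k => // x y; exact: complexI. Qed.

Lemma of_real_modulus (z : scalars R k) : of_real (modulus z) = `|z|.
Proof. by case: k z. Qed.

Lemma modulus_ge0 (z : scalars R k) : 0 <= modulus z.
Proof. by rewrite -ler_of_real of_real0 of_real_modulus. Qed.

Lemma of_realV x : of_real x^-1 = (of_real x)^-1.
Proof. by case: k => //; exact: (fmorphV (real_complex R)). Qed.

End scalars_theory.

Section algebraic_dual.
Variables (K : numFieldType) (V : lmodType K).

Local Notation algdual := {linear V -> K^o}.

Implicit Types f g h : algdual.

HB.instance Definition _ := gen_eqMixin algdual.
HB.instance Definition _ := gen_choiceMixin algdual.

Lemma algdual_ext f g : f =1 g -> f = g.
Proof.
case: f g => f [[fD] [fZ]] [g [[gD] [gZ]]] /= fg.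
have {}fg := funext fg; subst g.
by rewrite (Prop_irrelevance fD gD) (Prop_irrelevance fZ gZ).
Qed.

Let zero : algdual := (\0 : V -> K^o).
Let add f g : algdual := (f \+ g : V -> K^o).
Let opp f : algdual := (\- f : V -> K^o).
Let scale (a : K) f : algdual := (a \*: f : V -> K^o).

Let addA : associative add.
Proof. by move=> f g h; apply: algdual_ext => v /=; rewrite addrA. Qed.
Let addC : commutative add.
Proof. by move=> f g; apply: algdual_ext => v /=; rewrite addrC. Qed.
Let add0 : left_id zero add.
Proof. by move=> f; apply: algdual_ext => v /=; rewrite add0r. Qed.
Let addN : left_inverse zero opp add.
Proof. by move=> f; apply: algdual_ext => v /=; rewrite addNr. Qed.

HB.instance Definition _ := GRing.isZmodule.Build algdual addA addC add0 addN.

Let scaleA a b f : scale a (scale b f) = scale (a * b) f.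
Proof. by apply: algdual_ext => v /=; rewrite scalerA. Qed.
Let scale1 : left_id 1 scale.
Proof. by move=> f; apply: algdual_ext => v /=; rewrite scale1r. Qed.
Let scaleDr : right_distributive scale +%R.
Proof. by move=> a f g; apply: algdual_ext => v /=; rewrite scalerDr. Qed.
Let scaleDl f : {morph scale^~ f : a b / a + b}.
Proof. by move=> a b; apply: algdual_ext => v /=; rewrite scalerDl. Qed.

HB.instance Definition _ :=
  GRing.Zmodule_isLmodule.Build K algdual scaleA scale1 scaleDr scaleDl.

Lemma algdual0E v : (0 : algdual) v = 0. Proof. by []. Qed.
Lemma algdualDE f g v : (f + g) v = f v + g v. Proof. by []. Qed.
Lemma algdualNE f v : (- f) v = - f v. Proof. by []. Qed.
Lemma algdualZE a f v : (a *: f) v = a * f v. Proof. by []. Qed.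

End algebraic_dual.

Notation algdual K V := {linear V -> K^o}.

(* With n = 0 the sum is empty, so that 0 always belongs to the span. *)
Definition in_lspan (K : numFieldType) (V : lmodType K) (S : set V) : {pred V} :=
  fun u => `[< exists (n : nat) (c : 'I_n -> K) (s : 'I_n -> V),
    (forall i, S (s i)) /\ u = \sum_i c i *: s i >].

Section lspan_closed.
Variables (K : numFieldType) (V : lmodType K) (S : set V).

Lemma in_lspan_submod : submod_closed (in_lspan S).
Proof.
split.
  apply/asboolP; exists 0%N, (fun=> 0), (fun=> 0).
  by split; [case|rewrite big_ord0].
move=> a u v /asboolP[n [c [s [Ss ->]]]] /asboolP[m [d [t [St ->]]]].
apply/asboolP; exists (n + m)%N,
  (fun i : 'I_(n + m) =>
     match fintype.split i with inl j => a * c j | inr j => d j end),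
  (fun i : 'I_(n + m) =>
     match fintype.split i with inl j => s j | inr j => t j end); split.
  by move=> i; case: fintype.split.
rewrite big_split_ord /= scaler_sumr; congr (_ + _); apply: eq_bigr => i _.
  by rewrite (unsplitK (inl i)) scalerA.
by rewrite (unsplitK (inr i)).
Qed.

HB.instance Definition _ :=
  GRing.isSubmodClosed.Build K V (in_lspan S) in_lspan_submod.

Lemma mem_lspan u : S u -> u \in in_lspan S.
Proof.
move=> Su; apply/asboolP; exists 1%N, (fun=> 1), (fun=> u).
by split=> //; rewrite big_ord1 scale1r.
Qed.

End lspan_closed.

Section topological_dual.
Variables (R : realType) (k : scalar_kind).
Local Notation K := (scalars R k).
Variable E : normedModType K.

Definition is_continuous : {pred algdual K E} :=
  fun phi => `[< continuous (phi : E -> K^o) >].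

Lemma is_continuous_submod : submod_closed is_continuous.
Proof.
split; first by apply/asboolP => x; exact: cvg_cst.
move=> a f g /asboolP fc /asboolP gc; apply/asboolP => x.
by apply: cvgD; [apply: cvgZl_tmp; exact: fc|exact: gc].
Qed.

HB.instance Definition _ :=
  GRing.isSubmodClosed.Build K (algdual K E) is_continuous
    is_continuous_submod.

Record dual := Dual {
  dual_val :> algdual K E ;
  dual_valP : dual_val \in is_continuous }.

HB.instance Definition _ := [isSub for dual_val].
HB.instance Definition _ := [Choice of dual by <:].
HB.instance Definition _ := [SubChoice_isSubLmodule of dual by <:].

Implicit Types phi psi : dual.

Definition opnorm phi : R :=
  sup [set modulus (phi e) | e in [set e : E | `|e| <= 1]].

Lemma dual_bounded phi :
  exists2 M : R, 0 <= M & forall e, `|phi e| <= of_real k M * `|e|.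
Proof.
have /asboolP phic := dual_valP phi.
have /linear_boundedP/pinfty_ex_gt0[r r0 phir] :=
  (linear_bounded_continuous (phi : {linear E -> K^o})).2 phic.
exists (modulus r) => [|e]; last by rewrite of_real_modulus (gtr0_norm r0).
exact: modulus_ge0.
Qed.

Lemma modulus_le_opnorm phi e : `|phi e| <= of_real k (opnorm phi) * `|e|.
Proof.
have [->|e0] := eqVneq e 0; first by rewrite linear0 !normr0 mulr0.
have ne0 : `|e| != 0 by rewrite normr_eq0.
rewrite -ler_pdivrMr ?normr_gt0// mulrC.
have -> : `|e|^-1 * `|phi e| = of_real k (modulus (phi (`|e|^-1 *: e))).
  by rewrite of_real_modulus linearZ normrM normfV normr_id.
rewrite ler_of_real; apply: ub_le_sup; last first.
  by exists (`|e|^-1 *: e) => //=; rewrite normrZ normfV normr_id mulVf.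
have [M M0 phiM] := dual_bounded phi; exists M => _ [v /= v1 <-].
rewrite -(ler_of_real k) of_real_modulus (le_trans (phiM v))//.
by rewrite ler_piMr// -(of_real0 R k) ler_of_real.
Qed.

Lemma opnorm_le phi M : 0 <= M ->
  (forall e, `|phi e| <= of_real k M * `|e|) -> opnorm phi <= M.
Proof.
move=> M0 phiM; apply: ge_sup.
  by exists (modulus (phi 0)), 0 => //=; rewrite normr0.
move=> _ [v /= v1 <-].
rewrite -(ler_of_real k) of_real_modulus (le_trans (phiM v))//.
by rewrite ler_piMr// -(of_real0 R k) ler_of_real.
Qed.

Lemma opnorm_ge0 phi : 0 <= opnorm phi.
Proof.
have [M M0 phiM] := dual_bounded phi.
have -> : 0 = modulus (phi 0) :> R.
  by apply: (@of_real_inj R k); rewrite of_real_modulus linear0 normr0 of_real0.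
apply: ub_le_sup; last by exists 0 => //=; rewrite normr0.
exists M => _ [v /= v1 <-].
rewrite -(ler_of_real k) of_real_modulus (le_trans (phiM v))//.
by rewrite ler_piMr// -(of_real0 R k) ler_of_real.
Qed.

Let dual_norm phi : K := of_real k (opnorm phi).

Let dual_normD phi psi : dual_norm (phi + psi) <= dual_norm phi + dual_norm psi.
Proof.
rewrite /dual_norm -of_realD ler_of_real; apply: opnorm_le.
  by rewrite addr_ge0 ?opnorm_ge0.
move=> e; rewrite of_realD mulrDl (le_trans (ler_normD _ _))//.
by apply: lerD; exact: modulus_le_opnorm.
Qed.

Let opnormZ_le a phi : opnorm (a *: phi) <= modulus a * opnorm phi.
Proof.
apply: opnorm_le => [|e].
  by rewrite mulr_ge0 ?opnorm_ge0// modulus_ge0.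
rewrite of_realM of_real_modulus -mulrA.
by rewrite [leLHS]normrM ler_wpM2l ?modulus_le_opnorm.
Qed.

Let dual_normZ a phi : dual_norm (a *: phi) = `|a| * dual_norm phi.
Proof.
rewrite /dual_norm -of_real_modulus -of_realM; congr of_real.
apply/eqP; rewrite eq_le opnormZ_le /=.
have [->|a0] := eqVneq a 0.
  suff -> : modulus (0 : K) = 0 by rewrite mul0r opnorm_ge0.
  by apply: (@of_real_inj R k); rewrite of_real_modulus normr0 of_real0.
have ma0 : 0 < modulus a.
  rewrite lt_neqAle modulus_ge0 andbT; apply: contra_neq a0 => ma0.
  by apply/normr0_eq0; rewrite -of_real_modulus -ma0 of_real0.
rewrite mulrC -ler_pdivlMr// mulrC.
have -> : (modulus a)^-1 = modulus a^-1.
  by apply: (@of_real_inj R k); rewrite of_realV !of_real_modulus normfV.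
by rewrite -{1}[phi](scalerK a0) opnormZ_le.
Qed.

Let dual_norm0_eq0 phi : dual_norm phi = 0 -> phi = 0.
Proof.
move=> phi0; apply/val_inj/algdual_ext => e /=; apply/normr0_eq0/eqP.
rewrite eq_le normr_ge0 andbT.
by have := modulus_le_opnorm phi e; rewrite -/(dual_norm phi) phi0 mul0r.
Qed.

HB.instance Definition _ :=
  Lmodule_isNormed.Build K dual dual_normD dual_normZ dual_norm0_eq0.

Lemma dual_normE phi : `|phi| = of_real k (opnorm phi).
Proof. by []. Qed.

End topological_dual.

#[short(type="pointedMetricType")]
HB.structure Definition PointedMetric (R : numDomainType) :=
  {X of Metric R X & isPointed X}.

Section Lipschitz.
Variables (R : realType) (k : scalar_kind).
Local Notation K := (scalars R k).
Variables (X : pointedMetricType R) (F : normedModType K).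

Definition is_lip0 : {pred X -> F} := fun f =>
  `[< f point = 0 /\
      exists L : R, forall x y, `|f x - f y| <= of_real k (L * mdist x y) >].

Lemma is_lip0_submod : submod_closed is_lip0.
Proof.
split.
  apply/asboolP; split=> //; exists 0 => x y.
  by rewrite subrr normr0 mul0r of_real0.
move=> a f g /asboolP[f0 [L fL]] /asboolP[g0 [M gM]]; apply/asboolP; split.
  by rewrite !fctE f0 g0 scaler0 addr0.
exists (modulus a * L + M) => x y; rewrite !fctE opprD addrACA -scalerBr.
rewrite mulrDl of_realD (le_trans (ler_normD _ _))// lerD//.
by rewrite normrZ -mulrA of_realM of_real_modulus ler_wpM2l.
Qed.

HB.instance Definition _ :=
  GRing.isSubmodClosed.Build K (X -> F) is_lip0 is_lip0_submod.

Record Lip0 := MkLip0 {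
  lip0_val :> X -> F ;
  lip0_valP : lip0_val \in is_lip0 }.

HB.instance Definition _ := [isSub for lip0_val].
HB.instance Definition _ := [Choice of Lip0 by <:].
HB.instance Definition _ := [SubChoice_isSubLmodule of Lip0 by <:].

End Lipschitz.
Arguments Lip0 {R k} X F.

Section Lipschitz_tensor_product.
Variables (R : realType) (k : scalar_kind).
Local Notation K := (scalars R k).
Variables (X : pointedMetricType R) (E : completeNormedModType K).

Definition delta_fun (x y : X) (e : E) (f : Lip0 X (dual E)) : K^o :=
  (f x - f y) e.

Lemma delta_fun_linear x y e : linear (delta_fun x y e).
Proof.
move=> a f g; rewrite /delta_fun.
have -> : (a *: f + g) x - (a *: f + g) y = a *: (f x - f y) + (g x - g y).
  by rewrite scalerBr addrACA -opprD.
by [].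
Qed.

HB.instance Definition _ x y e :=
  GRing.isLinear.Build K (Lip0 X (dual E)) K^o _ (delta_fun x y e)
    (delta_fun_linear x y e).

Definition delta x y e : algdual K (Lip0 X (dual E)) := delta_fun x y e.

(* The span is a subtype of the algebraic dual of Lip0 X (dual E): two elements
   of X (x) E are equal iff they agree as functionals, so an element may have
   several representations as a sum of boxtimes. *)
Definition is_tensor : {pred algdual K (Lip0 X (dual E))} :=
  in_lspan [set delta p.1.1 p.1.2 p.2 | p in [set: X * X * E]].

HB.instance Definition _ := GRing.SubmodClosed.on is_tensor.

Record tensor := Tensor {
  tensor_val :> algdual K (Lip0 X (dual E)) ;
  tensor_valP : tensor_val \in is_tensor }.

HB.instance Definition _ := [isSub for tensor_val].
HB.instance Definition _ := [Choice of tensor by <:].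
HB.instance Definition _ := [SubChoice_isSubLmodule of tensor by <:].

Lemma delta_is_tensor x y e : delta x y e \in is_tensor.
Proof. by apply: mem_lspan; exists (x, y, e). Qed.

Definition boxtimes x y e : tensor := Tensor (delta_is_tensor x y e).

(* phi sends every representation of a tensor to the corresponding sum; the
   existence of such a phi is the well-definedness of Lambda(f). *)
Definition is_Lambda (f : Lip0 X (dual E)) (phi : tensor -> K^o) : Prop :=
  forall (n : nat) (x y : 'I_n -> X) (e : 'I_n -> E),
    phi (\sum_i boxtimes (x i) (y i) (e i)) =
    \sum_i (f (x i) - f (y i)) (e i).

End Lipschitz_tensor_product.
Arguments tensor {R k} X E.

(* Main.v *)
Require Import Defs.
From HB Require Import structures.
From mathcomp Require Import all_boot all_order all_algebra.
From mathcomp Require Import boolp classical_sets functions reals.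
From mathcomp Require Import topology normedtype.
Import numFieldNormedType.Exports.
Local Open Scope ring_scope.

(** An element [u] of the tensor product is itself a functional on the Lipschitz
    maps, so [Lambda f] can be taken to be evaluation at [f], that is
    [u |-> u f]. This removes the question of well-definedness: the evaluation
    never looks at a representation of [u], and it takes the required value on
    each of them because addition and scaling of functionals are pointwise.

    The condition [is_Lambda f] leaves no other choice: it prescribes the value
    at every finite sum of elementary tensors, and these sums exhaust the tensor
    product ([tensor_sum_boxtimes]).

    For injectivity, the elementary tensors based at the distinguished point
    suffice: as [f] vanishes there, evaluation at [f] sends
    [boxtimes x point e] to [f x e] ([boxtimes_pointE]), so that it
    determines [f]. *)

Section Lambda.
Import GRing.Theory.
Set Implicit Arguments.
Variables (R : realType) (k : scalar_kind).
Local Notation K := (scalars R k).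
Variables (X : pointedMetricType R) (E : completeNormedModType K).
Implicit Types (f : Lip0 X (dual E)) (u : tensor X E) (phi : tensor X E -> K^o).

(** A scalar can be absorbed into the vector, which is why sums without
    coefficients are enough to describe the span. *)
Lemma scale_boxtimes (a : K) (x y : X) (e : E) :
  a *: boxtimes x y e = boxtimes x y (a *: e).
Proof.
apply/val_inj/algdual_ext => f /=.
by rewrite /delta_fun linearZ.
Qed.

Lemma tensor_sum_boxtimes u :
  exists (n : nat) (x y : 'I_n -> X) (e : 'I_n -> E),
    u = \sum_i boxtimes (x i) (y i) (e i).
Proof.
have /asboolP[n [c [s [s_delta u_sum]]]] := tensor_valP u.
have /choice[p p_s] : forall i, exists p : X * X * E,
    delta p.1.1 p.1.2 p.2 = s i.
  by move=> i; have [p _ <-] := s_delta i; exists p.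
exists n, (fun i => (p i).1.1), (fun i => (p i).1.2),
  (fun i => c i *: (p i).2).
apply: val_inj; rewrite raddf_sum [LHS]u_sum; apply: eq_bigr => i _.
by rewrite -scale_boxtimes -p_s.
Qed.

Definition tensor_eval f u : K^o := tensor_val u f.

Lemma tensor_eval_linear f : linear (tensor_eval f).
Proof. by []. Qed.

HB.instance Definition _ f :=
  GRing.isLinear.Build K (tensor X E) K^o _ (tensor_eval f)
    (tensor_eval_linear f).

Lemma tensor_eval_is_Lambda f : is_Lambda f (tensor_eval f).
Proof. by move=> n x y e; rewrite raddf_sum. Qed.

Lemma is_Lambda_unique f phi : is_Lambda f phi -> phi = tensor_eval f.
Proof.
move=> phiP; apply/funext => u.
have [n [x [y [e ->]]]] := tensor_sum_boxtimes u.
by rewrite phiP tensor_eval_is_Lambda.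
Qed.

Lemma lip0_point f : f point = 0.
Proof. by have /asboolP[] := lip0_valP f. Qed.

Lemma boxtimes_pointE f (x : X) (e : E) :
  tensor_eval f (boxtimes x point e) = f x e.
Proof. by rewrite /tensor_eval /= /delta_fun lip0_point subr0. Qed.

Definition Lambda f : algdual K (tensor X E) := tensor_eval f.

Lemma Lambda_linear : linear Lambda.
Proof.
by move=> a f g; apply: algdual_ext => u; exact: (linearP (tensor_val u)).
Qed.

HB.instance Definition _ :=
  GRing.isLinear.Build K (Lip0 X (dual E)) (algdual K (tensor X E)) _ Lambda
    Lambda_linear.

Lemma Lambda_inj : injective Lambda.
Proof.
move=> f g fg; apply/val_inj/funext => x; apply/val_inj/algdual_ext => e /=.
by rewrite -!boxtimes_pointE -[LHS]/(Lambda f _) fg.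
Qed.

End Lambda.

Theorem corollary1p9 (R : realType) (k : scalar_kind)
    (X : pointedMetricType R) (E : completeNormedModType (scalars R k)) :
  [/\ (forall f : Lip0 X (dual E),
         exists! phi : tensor X E -> (scalars R k)^o, is_Lambda f phi),
      (forall (f : Lip0 X (dual E)) (phi : tensor X E -> (scalars R k)^o),
         is_Lambda f phi -> linear phi) &
      exists Lambda :
          {linear Lip0 X (dual E) -> algdual (scalars R k) (tensor X E)},
        (forall f : Lip0 X (dual E), is_Lambda f (Lambda f)) /\
        injective Lambda].
Proof.
split.
- move=> f; exists (tensor_eval f); split.
    exact: tensor_eval_is_Lambda.
  by move=> phi /is_Lambda_unique.
- by move=> f phi /is_Lambda_unique ->; exact: tensor_eval_linear.
- exists (@Lambda R k X E); split; last exact: Lambda_inj.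
  exact: tensor_eval_is_Lambda.
Qed.
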